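(* There is a proper holomorphic self-map $f:\mathbb G_d\to\mathbb G_d$ of the symmetrized polydisc, not biholomorphic, with $\mathrm{Deck}(f)=\{\mathrm{identity}\}$.
   Context: $\mathbb D$ is the open unit disc in $\mathbb C$, $d\ge 1$; $s=(s_1,\ldots,s_d):\mathbb C^d\to\mathbb C^d$ is the symmetrization map, where $s_i(z)=\sum_{1\le k_1<\cdots<k_i\le d}z_{k_1}\cdots z_{k_i}$, and $\mathbb G_d:=s(\mathbb D^d)$ is the symmetrized polydisc (a bounded domain). A holomorphic map $f:\Omega_1\to\Omega_2$ between bounded domains in $\mathbb C^d$ is proper if preimages of compact sets are compact. Let $V_f=\{z\in\Omega_1:J_f(z)=0\}$ be its branch locus, $J_f$ being the complex Jacobian determinant. Then $f$ restricts to an unbranched analytic covering $\Omega_1\setminus f^{-1}f(V_f)\to\Omega_2\setminus f(V_f)$, and $\mathrm{Deck}(f)$ is the group of deck transformations of this covering, i.e. the group of biholomorphisms $h$ of $\Omega_1\setminus f^{-1}f(V_f)$ onto itself with $f\circ h=f$. *)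

(* Defs.v *)
From HB Require Import structures.
From mathcomp Require Import all_boot all_order all_algebra.
From mathcomp Require Import complex.
From mathcomp Require Import all_classical all_reals all_analysis.

Set Implicit Arguments.
Unset Strict Implicit.
Unset Printing Implicit Defensive.

Import Order.TTheory GRing.Theory Num.Theory.
Import numFieldNormedType.Exports.

Local Open Scope classical_set_scope.
Local Open Scope ring_scope.

(* R[i] packaged as an abstract number field, so that the generic topology and
   normed-module instances (and those of matrices over them) are found; in
   particular [differentiable] on 'rV[C R]_d is complex differentiability.
   [`|z|] is the modulus, seen in [C R], whose order is partial. *)
Definition C (R : realType) : numClosedFieldType := R[i]%C.

Section SeveralComplexVariables.
Variables (R : realType) (d : nat).
Local Notation Cd := 'rV[C R]_d.
Implicit Types (U V Omega : set Cd) (f h : Cd -> Cd).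

(* Maps are total functions on C^d, of which only the values on an open set [U]
   matter. *)
Definition holomorphic_on U f := forall z, U z -> differentiable f z.

Definition biholomorphic U V f :=
  holomorphic_on U f /\ {homo f : z / U z >-> V z} /\
  exists g : Cd -> Cd,
    [/\ holomorphic_on V g, {homo g : w / V w >-> U w},
        forall z, U z -> g (f z) = z & forall w, V w -> f (g w) = w].

Definition proper_holomorphic Omega1 Omega2 f :=
  [/\ holomorphic_on Omega1 f,
      {homo f : z / Omega1 z >-> Omega2 z} &
      forall K, K `<=` Omega2 -> compact K -> compact (Omega1 `&` f @^-1` K)].

Definition Jac f (z : Cd) : C R := \det ('J f z).

Definition branch_locus Omega f := [set z | Omega z /\ Jac f z = 0].

Definition covering_space Omega f :=
  Omega `\` f @^-1` (f @` branch_locus Omega f).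

(* A deck transformation is only defined on [covering_space Omega f]; it is
   represented by its unique total extension that is the identity elsewhere, so
   that equality in [Deck Omega f] is equality of deck transformations. *)
Definition Deck Omega f : set (Cd -> Cd) :=
  let D := covering_space Omega f in
  [set h | [/\ biholomorphic D D h,
               forall z, D z -> f (h z) = f z &
               forall z, ~ D z -> h z = z]].

Definition polydisc : set Cd := [set z | forall i, `|z 0 i| < 1].

(* The coordinate of index [i : 'I_d] (counted from 0) is the elementary
   symmetric polynomial of degree [i.+1]; the sets [A] are the
   [{k_1 < ... < k_(i.+1)}]. *)
Definition symmetrization (z : Cd) : Cd :=
  \row_(i < d) \sum_(A : {set 'I_d} | #|A| == i.+1) \prod_(k in A) z 0 k.

Definition symmetrized_polydisc : set Cd := symmetrization @` polydisc.

End SeveralComplexVariables.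

Arguments polydisc R d : clear implicits.
Arguments symmetrized_polydisc R d : clear implicits.

(* Main.v *)
Require Import Defs.
From HB Require Import structures.
From mathcomp Require Import all_boot all_order all_algebra perm.
From mathcomp Require Import complex.
From mathcomp Require Import all_classical all_reals all_analysis.
From mathcomp Require Import ring lra.
From mathcomp Require Import -(notations) mpoly.

(** Write [s] for the symmetrization map and let [B] be the Blaschke product
    [B x = x^2 (2 x - 1) / (2 - x)]. The map [f] of the theorem is the one
    induced by [B] on the coordinates: [f (s z) = s (B z_1, ..., B z_d)]. The
    numerators and the denominator of the right-hand side are symmetric
    polynomials in [z], hence polynomials in [s z] by the fundamental theorem of
    symmetric polynomials, so [f] exists and is holomorphic
    ([symmetric_rational], [induced_exists]).

    Properness ([induced_proper]): [B] maps the open disc to itself and the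
    unit circle to itself, so the part of the closed polydisc which
    [s] after [B] sends into a compact [K] contained in the symmetrized
    polydisc is a compact subset of the open polydisc, and [s] maps it onto the
    preimage of [K]. The map is not injective since [B 0 = B (1/2) = 0].

    Triviality of the deck group: [B] has degree three, and its fibre over [0]
    consists of the double point [0] and of the simple point [1/2]. Take a
    continuous map [v] on a punctured disc that moves each point inside its
    fibre of [B], that is, [B (v x) = B x]. If [v] is not the identity then
    [v x] differs from [x] everywhere, by connectedness, and for [x] turning
    around [1/2] the point [v x] is one of the two points of the fibre close to
    [0]. These two points are exchanged when [x] makes one turn, a
    contradiction; so [v] is the identity ([lift_identity]).

    In dimension [d] call [z] regular when the [B z_k] are distinct and are not
    critical values of [B]. Then [s z] lies in the total space of the covering
    ([regular_covering]), since the Jacobian of [f] is nonzero over such points.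
    Given a deck transformation [h] and a regular [z], move one coordinate
    [x = z_i] and keep the others: [h (s z)] has exactly one root in the fibre
    of [x], this root depends continuously on [x] ([root_near]), and so it is
    [x] by the one-variable result. All the [z_i] are therefore roots of
    [h (s z)], that is [h (s z) = s z] ([deck_fixes_regular]). Regular points
    are dense ([regular_dense]), and [h] is the identity by continuity
    ([deck_trivial]). *)

Set Implicit Arguments.
Unset Strict Implicit.
Unset Printing Implicit Defensive.

Import Order.TTheory GRing.Theory Num.Theory.
Import numFieldNormedType.Exports.

Local Open Scope classical_set_scope.
Local Open Scope ring_scope.

(** * Symmetrization and roots of monic polynomials *)

Section Roots.
Variables (R : realType) (d : nat).
Local Notation Cd := 'rV[C R]_d.
Implicit Types (z u s : Cd) (t : C R).

(** The value at [t] of the monic polynomial whose coefficients are, up to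
    sign, the coordinates of [s]. *)
Definition monic_eval s t : C R :=
  t ^+ d + \sum_(i < d) (-1) ^+ i.+1 * s 0 i * t ^+ (d - i.+1).

(** Vieta: the symmetrization of [z] encodes the monic polynomial with roots
    [z], so that questions on fibres of the symmetrization are questions on
    roots. *)
Lemma monic_eval_symmetrization z t :
  monic_eval (symmetrization z) t = \prod_(k < d) (t - z 0 k).
Proof.
rewrite (eq_bigr (fun k => - z 0 k + t)); last by move=> k _; rewrite addrC.
rewrite bigA_distr /=.
pose F (A : {set 'I_d}) : C R := \prod_i (if i \in A then - z 0 i else t).
have FE A : F A = (-1) ^+ #|A| * (\prod_(k in A) z 0 k) * t ^+ (d - #|A|).
  rewrite /F (bigID (mem A)) /=.
  rewrite (eq_bigr (fun i => -1 * z 0 i)); last by move=> i ->; rewrite mulN1r.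
  rewrite big_split /= prodr_const; congr (_ * _).
  rewrite (eq_bigr (fun=> t)); last by move=> i /negbTE ->.
  have cC : (d - #|A| = #|[predC A]|)%N.
    by rewrite -(addKn #|A| #|[predC A]|) cardC card_ord.
  by rewrite prodr_const cC.
rewrite -/(\sum_(J : {set 'I_d}) F J).
rewrite (partition_big (fun A : {set 'I_d} => inord #|A| : 'I_d.+1) predT) //=.
rewrite big_ord_recl /=; congr (_ + _).
  rewrite (big_pred1 finset.set0) ?FE ?cards0 ?big_set0 ?subn0 ?mul1r ?mulr1 // => A.
  rewrite -val_eqE /= inordK ?cards_eq0 //.
  by rewrite ltnS -[X in (_ <= X)%N]card_ord max_card.
apply: eq_bigr => i _; rewrite mxE mulr_sumr mulr_suml.
apply: eq_big => A.
  rewrite -val_eqE /= inordK ?lift0 //.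
  by rewrite ltnS -[X in (_ <= X)%N]card_ord max_card.
by move/eqP => cA; rewrite FE cA.
Qed.

Lemma symmetrization_mem z u :
  symmetrization z = symmetrization u -> forall k, exists l, z 0 k = u 0 l.
Proof.
move=> e k; have := monic_eval_symmetrization u (z 0 k).
rewrite -e monic_eval_symmetrization (bigD1 k) //= subrr mul0r => /esym/eqP.
by move/prodf_eq0 => [l _]; rewrite subr_eq0 => /eqP ->; exists l.
Qed.

Lemma symmetrization_reindex z (g : 'I_d -> 'I_d) : injective g ->
  symmetrization (\row_k z 0 (g k)) = symmetrization z.
Proof.
move=> ig; apply/rowP => i; rewrite !mxE.
have iG : injective (fun A : {set 'I_d} => [set g x | x in A]%SET).
  exact: imset_inj.
rewrite [RHS](reindex_inj iG) /=; apply: eq_big => A; first by rewrite card_imset.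
move=> _; rewrite big_imset /=; last by move=> x y _ _; apply: ig.
by apply: eq_bigr => k _; rewrite mxE.
Qed.

(** When [z] has distinct coordinates, the choice of a coordinate of [u] equal
    to each coordinate of [z] is a permutation. *)
Lemma symmetrization_inj z u : symmetrization z = symmetrization u ->
  injective (z 0) -> injective (u 0).
Proof.
move=> e iz.
have [g gE] := choice (symmetrization_mem e).
have ig : injective g by move=> k l gkl; apply: iz; rewrite !gE gkl.
have [g' _ gK] := injF_bij ig.
by move=> k l; rewrite -[k]gK -[l]gK -!gE => /iz ->.
Qed.

Lemma eq_symmetrization z u : injective (z 0) ->
  (forall k, exists l, z 0 k = u 0 l) -> symmetrization z = symmetrization u.
Proof.
move=> iz /choice[g gE].
have ig : injective g by move=> k l gkl; apply: iz; rewrite !gE gkl.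
rewrite -(symmetrization_reindex u ig); congr symmetrization.
by apply/rowP => k; rewrite mxE gE.
Qed.

Lemma polydisc_symmetrization z u : symmetrization z = symmetrization u ->
  polydisc R d u -> polydisc R d z.
Proof. by move=> /symmetrization_mem e pu k; have [l ->] := e k. Qed.

End Roots.

(** * Rational maps on the quotient by permutations *)

Section DifferentiableBig.
Variables (K : numFieldType) (V : normedModType K).

Lemma differentiable_bigsum (W : normedModType K) (I : Type) (r : seq I)
    (F : I -> V -> W) (x : V) :
  (forall i, differentiable (F i) x) ->
  differentiable (fun y => \sum_(i <- r) F i y) x.
Proof.
move=> dF; elim: r => [|i r IH].
  by under eq_fun do rewrite big_nil; exact: differentiable_cst.
by under eq_fun do rewrite big_cons; exact: differentiableD.
Qed.

Lemma differentiable_bigprod (I : Type) (r : seq I) (P : pred I) (F : I -> V -> K)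
    (x : V) : (forall i, P i -> differentiable (F i) x) ->
  differentiable (fun y => \prod_(i <- r | P i) F i y) x.
Proof.
move=> dF; elim: r => [|i r IH].
  by under eq_fun do rewrite big_nil; exact: differentiable_cst.
under eq_fun do rewrite big_cons.
by case Pi: (P i); [apply: differentiableM => //; exact: dF | exact: IH].
Qed.

Lemma differentiable_pow (f : V -> K) m (x : V) :
  differentiable f x -> differentiable (fun y => f y ^+ m) x.
Proof.
move=> df; have -> : (fun y => f y ^+ m) = (fun y => \prod_(i < m) f y).
  by apply/funext => y; rewrite prodr_const card_ord.
by apply: differentiable_bigprod.
Qed.

Lemma differentiable_row n (F : 'I_n -> V -> K) (x : V) :
  (forall i, differentiable (F i) x) ->
  differentiable (fun y => \row_(i < n) F i y) x.
Proof.
move=> dF.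
have -> : (fun y => \row_(i < n) F i y) =
    (fun y => \sum_(i < n) F i y *: (delta_mx 0 i : 'rV[K]_n)).
  apply/funext => y; apply/rowP => j; rewrite mxE summxE (bigD1 j) //= big1.
    by rewrite !mxE !eqxx mulr1 addr0.
  by move=> i /negbTE ij; rewrite !mxE eq_sym ij mulr0.
by apply: differentiable_bigsum => i; apply: differentiableZl.
Qed.

End DifferentiableBig.

Section SymmetricRational.
Variables (R : realType) (d : nat).
Local Notation Cd := 'rV[C R]_d.
Local Notation Mp := (mpoly d (C R)).

Lemma differentiable_meval (p : Mp) (s : Cd) :
  differentiable (fun s : Cd => meval (s 0) p) s.
Proof.
under eq_fun do rewrite mevalE.
apply: differentiable_bigsum => m.
apply: differentiableM; first exact: differentiable_cst.
apply: differentiable_bigprod => i _.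
by apply: differentiable_pow; apply: differentiable_coord.
Qed.

Let inX (P : {poly C R}) (k : 'I_d) : Mp :=
  \sum_(i < size P) P`_i *: (mpolyX (C R) (mnm1 k)) ^+ i.

Let meval_inX P k (z : Cd) : meval (z 0) (inX P k) = P.[z 0 k].
Proof.
rewrite raddf_sum horner_coef; apply: eq_bigr => i _.
by rewrite /= mevalZ rmorphXn /= mevalXU.
Qed.

Let msym_inX P k (g : 'S_d) : msym g (inX P k) = inX P (g k).
Proof.
rewrite raddf_sum; apply: eq_bigr => i _.
by rewrite /= msymZ rmorphXn /= /msym mmapX mmap1U.
Qed.

Lemma symmetrization_mesym (z : Cd) i :
  meval (z 0) (mesym d (C R) i.+1) =
  \sum_(A : {set 'I_d} | #|A| == i.+1) \prod_(k in A) z 0 k.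
Proof.
rewrite raddf_sum; apply: eq_bigr => A _.
by rewrite /= rmorph_prod; apply: eq_bigr => k _; rewrite /= mevalXU.
Qed.

(** The fundamental theorem of symmetric polynomials, read on values. *)
Lemma symmetric_eval (p : Mp) : p \is symmetric ->
  exists q : Mp, forall z : Cd, meval (symmetrization z 0) q = meval (z 0) p.
Proof.
move=> /sym_fundamental[q [qp _]]; exists q => z.
rewrite -[in RHS]qp comp_mpoly_meval; apply: meval_eq => i.
by rewrite tnth_mktuple symmetrization_mesym mxE.
Qed.

(** Applying one rational function [P / Q] to all coordinates commutes with
    permutations, so it descends through the symmetrization. Over the common
    denominator, the product of the [Q (z k)], the numerator of the elementary
    symmetric function of degree [i.+1] is the sum over the sets [A] of that
    cardinal of the products of the [P (z k)] for [k] in [A] and of the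
    [Q (z k)] for the other [k]; both are symmetric polynomials. *)
Lemma symmetric_rational (P Q : {poly C R}) :
  exists f : Cd -> Cd, forall z : Cd, (forall k, Q.[z 0 k] != 0) ->
    f (symmetrization z) = symmetrization (\row_k (P.[z 0 k] / Q.[z 0 k])) /\
    differentiable f (symmetrization z).
Proof.
pose num (i : 'I_d) : Mp := \sum_(A : {set 'I_d} | #|A| == i.+1)
  \prod_(k < d) (if k \in A then inX P k else inX Q k).
pose den : Mp := \prod_(k < d) inX Q k.
have num_sym i : num i \is symmetric.
  apply/issymP => g; rewrite /num raddf_sum /=.
  have ig : injective (fun A : {set 'I_d} => [set g x | x in A]%SET).
    by apply: imset_inj; apply: perm_inj.
  rewrite [RHS](reindex_inj ig) /=; apply: eq_big => A.
    by rewrite card_imset //; apply: perm_inj.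
  move=> _; rewrite rmorph_prod /= [RHS](reindex_inj (@perm_inj _ g)) /=.
  apply: eq_bigr => k _; rewrite mem_imset; last exact: perm_inj.
  by case: (k \in A); rewrite msym_inX.
have den_sym : den \is symmetric.
  apply/issymP => g; rewrite /den rmorph_prod /=.
  rewrite [RHS](reindex_inj (@perm_inj _ g)) /=.
  by apply: eq_bigr => k _; rewrite msym_inX.
have [qn qnE] := choice (fun i => symmetric_eval (num_sym i)).
have [qd qdE] := symmetric_eval den_sym.
exists (fun s : Cd => \row_i (meval (s 0) (qn i) / meval (s 0) qd)) => z Q0.
have den0 : meval (z 0) den != 0.
  rewrite rmorph_prod /=; apply/prodf_neq0 => k _.
  by rewrite meval_inX.
split.
  apply/rowP => i; rewrite !mxE qnE qdE.
  rewrite raddf_sum /= mulr_suml; apply: eq_bigr => A _.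
  rewrite !rmorph_prod /= [in RHS]big_mkcond /= -prodf_div.
  apply: eq_bigr => k _; rewrite mxE.
  by case: ifP => _; rewrite !meval_inX // divff.
apply: differentiable_row => i; apply: differentiableM.
  exact: differentiable_meval.
apply: differentiableV; first exact: differentiable_meval.
by rewrite qdE.
Qed.

End SymmetricRational.

(** * Topology of the complex plane *)

Lemma near_dist_lt (K : numFieldType) (V : pseudoMetricNormedZmodType K) (x : V) (e : K) :
  0 < e -> \forall y \near x, `|x - y| < e.
Proof.
move=> e0; apply/nbhs_ballP; exists e => //= y.
by rewrite -ball_normE.
Qed.

(** Instance resolution does not see through the name [C R]. *)
#[global] Instance C_nbhs_filter (R : realType) (x : C R) : ProperFilter (nbhs x).
Proof. exact: nbhs_pfilter. Qed.

#[global] Instance rV_nbhs_filter (R : realType) (n : nat) (z : 'rV[C R]_n) :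
  ProperFilter (nbhs z).
Proof. exact: nbhs_pfilter. Qed.

Lemma near_norm_lt (R : realType) (x r : C R) :
  `|x| < r -> \forall y \near x, `|y| < r.
Proof.
rewrite -subr_gt0 => xr; apply: filterS (near_dist_lt x xr) => y xy.
rewrite -[y](subrK x) (le_lt_trans (ler_normD _ _)) // distrC.
by rewrite -ltrBrDr.
Qed.

Section ComplexLine.
Variable R : realType.
Implicit Types (x y : C R) (t : R).

Definition cplx t : C R := (t%:C)%C.
Definition Cre x : R := complex.Re x.
Definition Cim x : R := complex.Im x.

Lemma cplx_continuous : continuous cplx.
Proof.
move=> t; apply/cvgrPdist_lt => e e0.
have eE : e = cplx (Cre e) by rewrite /cplx RRe_real // gtr0_real.
have r0 : 0 < Cre e by rewrite -ltcR; move: e0; rewrite {1}eE.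
apply: filterS (near_dist_lt t r0) => s ts.
by rewrite eE /cplx -[X in `|X|]rmorphB normc_def /= expr0n addr0 sqrtr_sqr ltcR.
Qed.

Lemma Cre_continuous : continuous Cre.
Proof.
move=> x; apply/cvgrPdist_lt => e e0.
have c0 : 0 < cplx e by rewrite ltcR.
apply: filterS (near_dist_lt x c0) => y xy; rewrite -ltcR.
have -> : Cre x - Cre y = Cre (x - y) by case: (x) (y) => a b [c f].
exact: le_lt_trans (normc_ge_Re _) xy.
Qed.

Lemma norm_cplx t : `|cplx t| = cplx `|t|.
Proof. by rewrite /cplx normc_def /= expr0n addr0 sqrtr_sqr. Qed.

Lemma cplxD s t : cplx (s + t) = cplx s + cplx t.
Proof. exact: (rmorphD (real_complex R)). Qed.

Lemma cplxB s t : cplx (s - t) = cplx s - cplx t.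
Proof. exact: (rmorphB (real_complex R)). Qed.

Lemma cplxM s t : cplx (s * t) = cplx s * cplx t.
Proof. exact: (rmorphM (real_complex R)). Qed.

Lemma cplx_le s t : (cplx s <= cplx t) = (s <= t).
Proof. exact: lecR. Qed.

Lemma cplx_lt s t : (cplx s < cplx t) = (s < t).
Proof. exact: ltcR. Qed.

Lemma cplx_Cre x : x \is Num.real -> cplx (Cre x) = x.
Proof. exact: RRe_real. Qed.

Lemma Cre_gt0 (c x : C R) : `|c - x| < c -> 0 < Cre x.
Proof.
move=> xc; have c0 : 0 < c by apply: le_lt_trans xc.
move: xc; rewrite -[c](cplx_Cre (gtr0_real c0)); move: (Cre c) => r xr.
have := le_lt_trans (normc_ge_Re (cplx r - x)) xr.
rewrite ltcR; case: x xr => a b _ /=; rewrite /Cre /= ltr_norml.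
by lra.
Qed.

(** Clamping the parameter extends a path from the unit interval to the whole
    real line, which spares continuity relative to a subset. *)
Definition clamp t : R := Num.max 0 (Num.min 1 t).

Lemma clamp_continuous : continuous clamp.
Proof.
move=> t; apply: continuous_max; first exact: cvg_cst.
by apply: continuous_min; [exact: cvg_cst | exact: cvg_id].
Qed.

Lemma clamp_ge0 t : 0 <= clamp t. Proof. by rewrite le_max lexx. Qed.

Lemma clamp_le1 t : clamp t <= 1.
Proof. by rewrite ge_max ler01 ge_min lexx. Qed.

Lemma clamp0 : clamp 0 = 0.
Proof. by rewrite /clamp (min_idPr _) ?ler01 // maxxx. Qed.

Lemma clamp1 : clamp 1 = 1.
Proof. by rewrite /clamp minxx (max_idPr _) ?ler01. Qed.

End ComplexLine.

Lemma near_notin_seq (K : numFieldType) (rs : seq K) (a : K) :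
  \forall x \near a, x != a -> x \notin rs.
Proof.
elim: rs => [|r rs IH]; first by near=> x.
have [->|ar] := eqVneq r a.
  near=> x => xa; rewrite inE negb_or xa /=.
  by move: xa; near: x.
have ar0 : 0 < `|a - r| by rewrite normr_gt0 subr_eq0 eq_sym.
apply: filterS2 IH (near_dist_lt a ar0) => x IHx ax xa.
rewrite inE negb_or IHx // andbT; apply: contraTneq ax => ->.
by rewrite ltxx.
Unshelve. all: by end_near. Qed.

Lemma exists_small_notin (R : realType) (rs : seq R) (e : R) : 0 < e ->
  exists t, [/\ 0 < t, t < e & t \notin rs].
Proof.
move=> e0; apply: (@filter_ex _ (0 : R)^'+).
near=> t; split; near: t.
- exact: nbhs_right_gt.
- exact: nbhs_right_lt.
- have [d /= d0 H] := (nbhs_ballP _ _).1 (near_notin_seq rs (0 : R)).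
  near=> t; apply: H; last by rewrite gt_eqF //; near: t; exact: nbhs_right_gt.
  rewrite /ball /= sub0r normrN gtr0_norm; near: t.
    exact: nbhs_right_lt.
  exact: nbhs_right_gt.
Unshelve. all: by end_near. Qed.

(** The continuity of sums and products is restated for functions into [C R]:
    the general results leave goals in which the operations come from other
    structures on the same field, and unification does not identify them. *)
Section ComplexContinuity.
Variables (R : realType) (T : topologicalType) (f g : T -> C R) (x : T).

Lemma continuous_cst (c : C R) : continuous_at x (fun _ : T => c).
Proof. exact: cvg_cst. Qed.

Lemma continuous_add : continuous_at x f -> continuous_at x g ->
  continuous_at x (fun y => f y + g y).
Proof. exact: cvgD. Qed.

Lemma continuous_sub : continuous_at x f -> continuous_at x g ->
  continuous_at x (fun y => f y - g y).
Proof. exact: cvgB. Qed.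

Lemma continuous_mul : continuous_at x f -> continuous_at x g ->
  continuous_at x (fun y => f y * g y).
Proof. exact: cvgM. Qed.

Lemma continuous_inv : f x != 0 -> continuous_at x f ->
  continuous_at x (fun y => (f y)^-1).
Proof. exact: cvgV. Qed.

End ComplexContinuity.

Arguments continuous_cst {R T x} c.
Arguments continuous_add {R T f g x} _ _.
Arguments continuous_sub {R T f g x} _ _.
Arguments continuous_mul {R T f g x} _ _.
Arguments continuous_inv {R T f x} _ _.

Lemma closed_set1C (R : realType) (c : C R) : closed [set c].
Proof.
by apply: accessible_closed_set1; apply: hausdorff_accessible; exact: norm_hausdorff.
Qed.

Lemma closed_zeros (R : realType) (T : topologicalType) (f : T -> C R) :
  continuous f -> closed [set t | f t = 0].
Proof. by move=> /continuous_closedP fc; exact: (fc _ (@closed_set1C R 0)). Qed.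

(** * A Blaschke product of degree three *)

Section Blaschke.
Variable R : realType.
Implicit Types x y : C R.

Definition blaschke x : C R := x ^+ 2 * (2 * x - 1) / (2 - x).

(** The difference quotient of [blaschke] between [y] and [x], without its
    denominators: the zeros of [secant ^~ x] are the other two points of the
    fibre of [x], and its zeros on the diagonal are the critical points. *)
Definition secant y x : C R :=
  2 * (2 - x) * y ^+ 2 + (2 * x - 1) * (2 - x) * y + 2 * x * (2 * x - 1).

Lemma blaschke_den x : `|x| <= 1 -> 2 - x != 0.
Proof.
rewrite subr_eq0; apply: contraTneq => <-.
by rewrite normr_nat lt_geF // ltr1n.
Qed.

Lemma blaschke_sub x y : 2 - x != 0 -> 2 - y != 0 ->
  blaschke y - blaschke x = (y - x) * (secant y x / ((2 - y) * (2 - x))).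
Proof. by move=> x0 y0; rewrite /blaschke /secant; field; rewrite x0 y0. Qed.

Lemma blaschke_eq x y : `|x| <= 1 -> `|y| <= 1 -> blaschke y = blaschke x ->
  y = x \/ secant y x = 0.
Proof.
move=> /blaschke_den x0 /blaschke_den y0 /eqP.
rewrite -subr_eq0 blaschke_sub // !mulf_eq0 invr_eq0 mulf_eq0 (negbTE x0) (negbTE y0).
by rewrite !orbF subr_eq0 => /orP[/eqP|/eqP]; [left|right].
Qed.

Lemma secant_diag x : secant x x = - (x * (4 * x ^+ 2 - 13 * x + 4)).
Proof. by rewrite /secant; ring. Qed.

(** Why [blaschke] is bounded by 1 on the disc, with equality on the circle. *)
Lemma blaschke_norm_den x : `|2 - x| ^+ 2 - `|2 * x - 1| ^+ 2 = 3 * (1 - `|x| ^+ 2).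
Proof.
rewrite !normCK !rmorphB !rmorphM /= !rmorph_nat rmorph1.
by ring.
Qed.

Lemma blaschke_norm x : `|x| <= 1 -> `|blaschke x| <= `|x| ^+ 2.
Proof.
move=> x1; rewrite /blaschke normrM normfV normrM normrX -mulrA.
rewrite ler_piMr ?exprn_ge0 // ler_pdivrMr ?normr_gt0 ?blaschke_den // mul1r.
rewrite -(ler_pXn2r (_ : 0 < 2)%N) ?nnegrE // -subr_ge0 blaschke_norm_den.
by rewrite mulr_ge0 ?ler0n // subr_ge0 exprn_ile1.
Qed.

Lemma blaschke_lt1 x : `|x| < 1 -> `|blaschke x| < 1.
Proof.
move=> x1; apply: le_lt_trans (blaschke_norm (ltW x1)) _.
by rewrite exprn_ilt1.
Qed.

Lemma blaschke_norm1 x : `|x| = 1 -> `|blaschke x| = 1.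
Proof.
move=> x1; have := blaschke_norm_den x.
rewrite x1 expr1n subrr mulr0 => /eqP; rewrite subr_eq0 eqrXn2 // => /eqP e.
rewrite /blaschke normrM normfV normrM normrX x1 expr1n mul1r -e divff //.
by rewrite normr_eq0 blaschke_den // x1.
Qed.

Lemma blaschke_continuous x : 2 - x != 0 -> {for x, continuous blaschke}.
Proof.
move=> x0; apply: cvgM; last first.
  apply: cvgV => //; apply: cvgB; [exact: cvg_cst | exact: cvg_id].
apply: cvgM; first by apply: cvgM; exact: cvg_id.
apply: (@cvgB _ _ _ _ _ (fun x => 2 * x) (cst 1)); last exact: cvg_cst.
exact: mulrl_continuous.
Qed.

(** Completing the square in the quadratic equation for the two other points
    of the fibre. The discriminant has a simple zero at [x = 1/2], and the
    second factor is positive there: the two points are exchanged around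
    [1/2]. *)
Lemma secant_square y x : 2 - x != 0 -> secant y x = 0 ->
  (4 * y + 2 * x - 1) ^+ 2 = (1 - 2 * x) * ((2 * x ^+ 2 + 11 * x + 2) / (2 - x)).
Proof.
move=> x0 s0; apply/eqP; rewrite -subr_eq0; apply/eqP.
rewrite -[RHS](mulr0 (8 / (2 - x))) -s0 /secant; field.
exact: x0.
Qed.

End Blaschke.

(** * Paths in a punctured disc *)

Section PuncturedDisc.
Variable R : realType.

Definition punctured_disc (rs : seq (C R)) : set (C R) :=
  [set x | `|x| < 1 /\ x \notin rs].

(** The segment from [p] to [q] is bent into a parabola by a small multiple [e]
    of its normal direction. A puncture lies on at most one such parabola, so
    that all but finitely many [e] give a path that avoids the punctures. *)
Lemma punctured_disc_path (rs : seq (C R)) (p q : C R) :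
  punctured_disc rs p -> punctured_disc rs q ->
  exists g : R -> C R, [/\ continuous g, forall t, punctured_disc rs (g t),
    g 0 = p & g 1 = q].
Proof.
move=> [p1 prs] [q1 qrs].
pose a := Cre `|p|; have aE : `|p| = cplx a by rewrite /cplx RRe_real.
pose b := Cre `|q|; have bE : `|q| = cplx b by rewrite /cplx RRe_real.
have a1 : a < 1 by rewrite -ltcR; move: p1; rewrite aE.
have b1 : b < 1 by rewrite -ltcR; move: q1; rewrite bE.
have a0 : 0 <= a by rewrite -lecR; have := normr_ge0 p; rewrite aE.
have b0 : 0 <= b by rewrite -lecR; have := normr_ge0 q; rewrite bE.
(* [bad r] is the only [e] for which the parabola can meet [r]. *)
pose bad (r : C R) : R := let rho := (r - p) / (q - p) in
  Cim rho / (Cre rho * (1 - Cre rho)).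
(* The bound on [e] keeps the parabola inside the unit disc. *)
have [|e [e0 ea ers]] := @exists_small_notin R (map bad rs) ((1 - a) / 2).
  by rewrite divr_gt0 // subr_gt0.
pose ii : C R := 'i%C.
have ii1 : `|ii| = 1 by rewrite /ii complexiE normCi.
pose w t : C R := Complex t (e * (t * (1 - t))).
have wE t : w t = cplx t + ii * cplx e * (cplx t * (1 - cplx t)).
  apply/eqP; rewrite eq_complex /=; apply/andP; split; apply/eqP; ring.
have wc : continuous w.
  move=> t; rewrite (_ : w = fun t => cplx t + ii * cplx e * (cplx t * (1 - cplx t))).
    apply: continuous_add; first exact: cplx_continuous.
    apply: continuous_mul; first exact: continuous_cst.
    apply: continuous_mul; first exact: cplx_continuous.
    apply: continuous_sub; first exact: continuous_cst.
    exact: cplx_continuous.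
  exact/funext.
exists (fun t => p + w (clamp t) * (q - p)); split.
- move=> t; apply: continuous_add; first exact: continuous_cst.
  apply: continuous_mul; last exact: continuous_cst.
  apply: (@continuous_comp _ _ _ (@clamp R) w); first exact: clamp_continuous.
  exact: wc.
- move=> t; have t0 := clamp_ge0 t; have t1 := clamp_le1 t.
  move: (clamp t) t0 t1 => {}t t0 t1; split.
    have -> : p + w t * (q - p) = cplx (1 - t) * p + cplx t * q +
        ii * (cplx (e * (t * (1 - t))) * (q - p)).
      by rewrite wE !(cplxM, cplxB); ring.
    have qp2 : `|q - p| <= cplx 2.
      apply: le_trans (ler_normB _ _) _; rewrite aE bE -cplxD cplx_le.
      lra.
    have ett0 : 0 <= e * (t * (1 - t)) by rewrite mulr_ge0 ?mulr_ge0 ?subr_ge0 // ltW.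
    apply: le_lt_trans (ler_normD _ _) _.
    apply: (@le_lt_trans _ _ (cplx ((1 - t) * a + t * b + e * (t * (1 - t)) * 2))).
      rewrite [leRHS]cplxD; apply: lerD.
        apply: le_trans (ler_normD _ _) _.
        rewrite [leRHS]cplxD !(cplxM _ a, cplxM _ b) !normrM aE bE !norm_cplx.
        by rewrite !ger0_norm // subr_ge0.
      rewrite normrM ii1 mul1r normrM norm_cplx (ger0_norm ett0) [leRHS]cplxM.
      by rewrite ler_pM // (cplx_le 0).
    rewrite (cplx_lt _ 1).
    have h1 : 0 <= t * (1 - t) by rewrite mulr_ge0 ?subr_ge0.
    have h2 : e * (t * (1 - t)) * 2 <= (1 - a) * (t * (1 - t)).
      by rewrite mulrAC ler_wpM2r // mulrC; move: ea; lra.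
    have h3 : 0 <= (1 - a) * (1 - t) ^+ 2 by rewrite mulr_ge0 ?sqr_ge0 // subr_ge0 ltW.
    move: t0; rewrite le_eqVlt => /orP[/eqP <-|t0]; first by lra.
    have h4 : 0 < t * (1 - b) by rewrite mulr_gt0 // subr_gt0.
    by move: h2 h3 h4; rewrite expr2; lra.
  apply/negP => rin; set r := p + _ in rin.
  have [pq|pq] := eqVneq q p.
    by move: rin prs; rewrite /r pq subrr mulr0 addr0 => ->.
  have rw : (r - p) / (q - p) = w t.
    by rewrite /r addrAC subrr add0r mulfK // subr_eq0.
  have bE' : bad r = e * (t * (1 - t)) / (t * (1 - t)) by rewrite /bad rw.
  have [tt0|tt0] := eqVneq (t * (1 - t)) 0; last first.
    by move: ers; rewrite -(mulfK tt0 e) -bE' map_f.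
  have := tt0; move=> /eqP; rewrite mulf_eq0 subr_eq0 => /orP[/eqP tE|/eqP tE].
    move: rin; rewrite /r wE tE /cplx rmorph0 !(mul0r, mulr0, addr0).
    by rewrite (negbTE prs).
  move: rin; rewrite /r wE -tE /cplx rmorph1 subrr !(mulr0, addr0) mul1r.
  by rewrite addrC subrK (negbTE qrs).
- by rewrite clamp0 wE /cplx rmorph0 !(mul0r, mulr0, addr0).
- by rewrite clamp1 wE /cplx rmorph1 subrr !(mulr0, addr0) mul1r addrC subrK.
Qed.

End PuncturedDisc.

(** * Continuous selections in the fibres of the Blaschke product *)

Section Monodromy.
Variable R : realType.

Lemma secant_continuous (T : topologicalType) (f g : T -> C R) (t : T) :
  continuous_at t f -> continuous_at t g ->
  continuous_at t (fun s => secant (f s) (g s)).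
Proof.
move=> fc gc; rewrite /secant.
have c2g : continuous_at t (fun s => 2 - g s).
  by apply: continuous_sub; [exact: continuous_cst | exact: gc].
have c2x : continuous_at t (fun s => 2 * g s).
  by apply: continuous_mul; [exact: continuous_cst | exact: gc].
have cg1 : continuous_at t (fun s => 2 * g s - 1).
  by apply: continuous_sub; [exact: c2x | exact: continuous_cst].
apply: continuous_add; last by apply: continuous_mul; [exact: c2x | exact: cg1].
apply: continuous_add; last first.
  apply: continuous_mul; last exact: fc.
  by apply: continuous_mul; [exact: cg1 | exact: c2g].
apply: continuous_mul; last by apply: continuous_mul; exact: fc.
by apply: continuous_mul; [exact: continuous_cst | exact: c2g].
Qed.

(** The real part of [k] cannot vanish, as [k t ^+ 2] would be nonpositive there;
    so it cannot change sign. *)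
Lemma no_odd_square_root (k : R -> C R) : continuous k -> k 1 = - k 0 ->
  ~ (forall t, 0 < Cre (k t ^+ 2)).
Proof.
move=> kc k1 kpos.
have g1 : Cre (k 1) = - Cre (k 0) by rewrite k1; case: (k 0).
have gc : continuous (fun t => Cre (k t)).
  by move=> t; apply: continuous_comp; [exact: kc | exact: Cre_continuous].
have [|||c _ kc0] := @IVT R (fun t => Cre (k t)) 0 1 0.
- exact: ler01.
- exact: continuous_subspaceT.
- rewrite g1; case: (lerP 0 (Cre (k 0))) => h.
    by rewrite ge_min le_max oppr_le0 h orbT.
  by rewrite ge_min le_max oppr_ge0 (ltW h) orbT.
move: (kpos c) kc0; case: (k c) => a b; rewrite /Cre expr2 /= => + a0.
by rewrite a0 mul0r sub0r oppr_gt0 -expr2 ltNge sqr_ge0.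
Qed.

(** For positive [r], a path from [r] to [- r] that avoids [0]; its square is a
    loop around [0]. *)
Let half_loop (r t : R) : C R := Complex (r * (1 - 2 * t)) (r * (t * (1 - t))).

Let half_loopE (r t : R) : half_loop r t =
  cplx r * (1 - 2 * cplx t + Complex 0 1 * (cplx t * (1 - cplx t))).
Proof. by apply/eqP; rewrite eq_complex /=; apply/andP; split; apply/eqP; ring. Qed.

Let half_loop_norm (r t : R) : 0 <= r -> 0 <= t <= 1 -> `|half_loop r t| <= cplx (r * 2).
Proof.
move=> r0 /andP[t0 t1].
have -> : half_loop r t = cplx r * (cplx (1 - 2 * t) + 'i * cplx (t * (1 - t))).
  by apply/eqP; rewrite -complexiE eq_complex /=; apply/andP; split; apply/eqP; ring.
rewrite normrM norm_cplx (ger0_norm r0) [leRHS]cplxM.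
apply: ler_pM; rewrite ?normr_ge0 ?(cplx_le 0) //.
apply: le_trans (ler_normD _ _) _; rewrite normrM normCi mul1r !norm_cplx -cplxD.
rewrite cplx_le (_ : 2 = 1 + 1) // lerD // ler_norml; first by apply/andP; split; lra.
by apply/andP; split; nra.
Qed.

Variables (rs : seq (C R)) (v : C R -> C R).
Local Notation W := (punctured_disc rs).
Hypothesis critical : forall x : C R, secant x x = 0 -> x \in rs.
Hypothesis v_continuous : forall x, W x -> continuous_at x v.
Hypothesis v_lt1 : forall x, W x -> `|v x| < 1.
Hypothesis v_lift : forall x, W x -> blaschke (v x) = blaschke x.

(** Along a path, the equations [v x = x] and [secant (v x) x = 0] define closed
    sets. These are complementary because critical points have been removed, and
    the line is connected. *)
Lemma lift_path (g : R -> C R) : continuous g -> (forall t, W (g t)) ->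
  v (g 0) = g 0 -> v (g 1) = g 1.
Proof.
move=> gc gW g0.
have vgc : continuous (v \o g).
  by move=> t; apply: continuous_comp; [exact: gc | exact: v_continuous].
have vgB t : v (g t) = g t <-> secant (v (g t)) (g t) <> 0.
  split=> [e|]; last first.
    by case: (blaschke_eq (ltW (gW t).1) (ltW (v_lt1 (gW t))) (v_lift (gW t))).
  by rewrite e => /critical; apply/negP; case: (gW t).
pose A := [set t | v (g t) = g t].
suff AT : A = [set: R] by have : A 1 by rewrite AT.
have /connected_intervalP connR : is_interval [set: R] by [].
apply: connR.
- by exists 0.
- exists [set t | secant (v (g t)) (g t) <> 0].
    rewrite (_ : mkset _ = ~` [set t | secant (v (g t)) (g t) = 0]) //.
    apply: closed_openC; apply: closed_zeros => t.
    by apply: secant_continuous; [exact: vgc | exact: gc].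
  by rewrite setTI; apply/seteqP; split=> t /vgB.
- exists [set t | v (g t) - g t = 0].
    apply: closed_zeros => t.
    by apply: continuous_sub; [exact: vgc | exact: gc].
  rewrite setTI; apply/seteqP; split=> t; rewrite /A /= => /eqP.
    by rewrite -subr_eq0 => /eqP.
  by rewrite subr_eq0 => /eqP.
Qed.

Lemma lift_propagates (x y : C R) : W x -> W y -> v x = x -> v y = y.
Proof.
move=> Wx Wy vx; have [g [gc gW g0 g1]] := punctured_disc_path Wx Wy.
by rewrite -g1; apply: lift_path; rewrite ?g0.
Qed.

(** Otherwise [v x] solves the quadratic equation of [secant_square] for all
    [x]. On the loop [x = 1/2 - eta ^+ 2 / 2], whose parameter [eta] runs over
    the half loop from [r] to [- r], the quotient [k] of the square root
    [4 * v x + 2 * x - 1] by [eta] changes sign from one end to the other, whereas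
    [k ^+ 2] keeps a positive real part. *)
Lemma lift_identity (x : C R) : W x -> v x = x.
Proof.
move=> Wx; apply: contrapT => vx.
have sec y : W y -> secant (v y) y = 0.
  move=> Wy; case: (blaschke_eq (ltW Wy.1) (ltW (v_lt1 Wy)) (v_lift Wy)) => // vy.
  by case: vx; exact: lift_propagates vy.
pose N y : C R := (2 * y ^+ 2 + 11 * y + 2) / (2 - y).
pose h : C R := 2^-1.
have h1 : `|h| < 1 by rewrite normfV normr_nat invf_lt1 ?ltr1n.
have N0 : 0 < N h.
  have -> : N h = 16 / 3 by rewrite /N /h; field.
  by rewrite divr_gt0 ?ltr0n.
have Nc : continuous_at h N.
  have idc : continuous_at h (fun y : C R => y) by exact: cvg_id.
  apply: continuous_mul; last first.
    apply: continuous_inv; first by apply: blaschke_den; exact: ltW.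
    by apply: continuous_sub; [exact: continuous_cst | exact: idc].
  apply: continuous_add; last exact: continuous_cst.
  apply: continuous_add; last first.
    by apply: continuous_mul; [exact: continuous_cst | exact: idc].
  apply: continuous_mul; first exact: continuous_cst.
  by apply: continuous_mul; exact: idc.
(* Near [1/2] the second factor [N] of the square has positive real part. *)
have nN : \forall y \near h, `|N h - N y| < N h by exact: (cvgr_dist_lt _ _ Nc).
have nd : \forall y \near h, `|y| < 1 by exact: near_norm_lt.
have [d /= d0 Hd] := (nbhs_ballP _ _).1 (filterI (filterI nN nd) (near_notin_seq rs h)).
have {}Hd y : `|h - y| < d -> [/\ 0 < Cre (N y), `|y| < 1 & y != h -> y \notin rs].
  move: Hd; rewrite -ball_normE /= => Hd hy.
  have [[Ny y1] yrs] := Hd y hy; split; [exact: Cre_gt0 Ny|exact: y1|exact: yrs].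
have dE : cplx (Cre d) = d by rewrite cplx_Cre // gtr0_real.
move: (Cre d) dE => D dE; rewrite -dE in d0 Hd.
have {d0} D0 : 0 < D by rewrite -(cplx_lt 0).
(* [2 * r] is smaller than both 1 and [D], so that [(2 * r) ^+ 2 / 2 < D]. *)
pose r : R := D / (2 * (1 + D)).
have r0 : 0 < r by rewrite divr_gt0 // mulr_gt0 // addr_gt0.
have r2 : 2 * r = D / (1 + D) by rewrite /r; field; apply/lt0r_neq0; lra.
have D1 : 0 < 1 + D by lra.
have r1 : 2 * r < 1 by rewrite r2 ltr_pdivrMr //; lra.
have rD : 2 * r < D by rewrite r2 ltr_pdivrMr //; nra.
move: r r0 r1 rD {r2} => r r0 r1 rD.
pose eta t := half_loop r (clamp t).
have etac : continuous eta.
  have cc : continuous (fun t : R => cplx (clamp t)).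
    move=> t; apply: continuous_comp; [exact: clamp_continuous|exact: cplx_continuous].
  move=> t; rewrite /eta (eq_fun (fun t => half_loopE r (clamp t))).
  apply: continuous_mul; first exact: continuous_cst.
  apply: continuous_add.
    apply: continuous_sub; first exact: continuous_cst.
    by apply: continuous_mul; [exact: continuous_cst | exact: cc].
  apply: continuous_mul; first exact: continuous_cst.
  apply: continuous_mul; first exact: cc.
  by apply: continuous_sub; [exact: continuous_cst | exact: cc].
have eta0 t : eta t != 0.
  rewrite /eta /half_loop; move: (clamp t) => {}t.
  apply/eqP => /eqP; rewrite eq_complex /= => /andP[].
  rewrite !mulf_eq0 (gt_eqF r0) /= => /eqP t2 /orP[/eqP|/eqP]; lra.
pose X t := h - eta t ^+ 2 / 2.
have Xh t : `|h - X t| < cplx D.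
  rewrite /X opprB addrC subrK normrM normfV normr_nat normrX.
  apply: (@le_lt_trans _ _ (cplx ((r * 2) ^+ 2 / 2))).
    have -> : cplx ((r * 2) ^+ 2 / 2) = cplx (r * 2) ^+ 2 / 2.
      by rewrite /cplx rmorphM rmorphXn /= fmorphV rmorph_nat.
    rewrite ler_pM2r ?invr_gt0 ?ltr0n // lerXn2r ?nnegrE ?normr_ge0 //.
      by rewrite (cplx_le 0) mulr_ge0 // ltW.
    by apply: half_loop_norm; rewrite ?clamp_ge0 ?clamp_le1 // ltW.
  rewrite cplx_lt; nra.
have Xneq t : X t != h.
  rewrite /X -subr_eq0 addrAC subrr add0r oppr_eq0.
  by apply: mulf_neq0; [rewrite expf_neq0 | rewrite invr_eq0 pnatr_eq0].
have WX t : W (X t) by have [_ X1 Xrs] := Hd _ (Xh t); split=> //; exact: Xrs.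
have Xc : continuous X.
  move=> t; apply: continuous_sub; first exact: continuous_cst.
  apply: continuous_mul; last exact: continuous_cst.
  by apply: continuous_mul; exact: etac.
pose k t := (4 * v (X t) + 2 * X t - 1) / eta t.
apply: (@no_odd_square_root k).
- move=> t; apply: continuous_mul; last first.
    by apply: continuous_inv; [exact: eta0 | exact: etac].
  apply: continuous_sub; last exact: continuous_cst.
  apply: continuous_add.
    apply: continuous_mul; first exact: continuous_cst.
    by apply: (@continuous_comp _ _ _ X v); [exact: Xc | exact: v_continuous].
  by apply: continuous_mul; [exact: continuous_cst | exact: Xc].
- have e1 : eta 1 = - eta 0.
    apply/eqP; rewrite /eta clamp0 clamp1 eq_complex /=.
    by apply/andP; split; apply/eqP; ring.
  by rewrite /k /X e1 sqrrN invrN mulrN.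
- move=> t; have [NX _ _] := Hd _ (Xh t).
  have -> : k t ^+ 2 = N (X t); last exact: NX.
  rewrite /k expr_div_n secant_square; last exact: sec.
    have -> : 1 - 2 * X t = eta t ^+ 2 by rewrite /X /h; field.
    by rewrite mulrAC divff ?mul1r // expf_neq0.
  by apply: blaschke_den; apply: ltW; case: (WX t).
Qed.

End Monodromy.

(** * The induced map *)

Section Jacobian.
Variable K : numFieldType.

Lemma jacobian_comp m n p (f : 'rV[K]_m -> 'rV[K]_n) (g : 'rV[K]_n -> 'rV[K]_p) a :
  differentiable f a -> differentiable g (f a) ->
  jacobian (g \o f) a = jacobian f a *m jacobian g (f a).
Proof.
move=> df dg; apply/row_matrixP => i.
by rewrite !rowE mulmxA /jacobian !mul_rV_lin1 diff_comp.
Qed.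

Lemma diff_proj n (a v : 'rV[K]_n) j : 'd (fun z : 'rV[K]_n => z 0 j) a v = v 0 j.
Proof.
have c_lin : linear (fun N : 'rV[K]_n => N 0 j : K^o).
  by move=> u y z; rewrite !mxE.
pose cM := GRing.isLinear.Build _ _ _ _ _ c_lin.
pose c : {linear 'rV[K]_n -> K^o} := HB.pack (fun N : 'rV[K]_n => N 0 j : K^o) cM.
have cc : continuous c by exact: coord_continuous.
exact: (congr1 (@^~ v) (diff_lin a cc)).
Qed.

Lemma diff_coord (V : normedModType K) n (f : V -> 'rV[K]_n) a v j :
  differentiable f a -> 'd (fun z => f z 0 j) a v = ('d f a v) 0 j.
Proof.
move=> df; rewrite -(diff_proj (f a)).
rewrite (_ : (fun z => f z 0 j) = (fun N : 'rV[K]_n => N 0 j) \o f) // diff_comp //.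
exact: differentiable_coord.
Qed.

Lemma jacobian_entry m n (f : 'rV[K]_m -> 'rV[K]_n) a i j : differentiable f a ->
  jacobian f a i j = 'D_(delta_mx 0 i) (fun z => f z 0 j) a.
Proof.
move=> df; rewrite deriveE; last first.
  exact: (differentiable_comp df (differentiable_coord _ _ _)).
have -> : jacobian f a i j = (row i (jacobian f a)) 0 j by rewrite [RHS]mxE.
by rewrite diff_coord // rowE /jacobian mul_rV_lin1.
Qed.

End Jacobian.

Section Symmetrization.
Variables (R : realType) (d : nat).
Local Notation Cd := 'rV[C R]_d.
Implicit Types (z u s : Cd).

Lemma symmetrization_differentiable z : differentiable (@symmetrization R d) z.
Proof.
apply: differentiable_row => i; under eq_fun do rewrite big_mkcond.
apply: differentiable_bigsum => A; case: (_ == _); last exact: differentiable_cst.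
by apply: differentiable_bigprod => k _; exact: differentiable_coord.
Qed.

Lemma monic_eval_differentiable (t : C R) s :
  differentiable (fun s : Cd => monic_eval s t) s.
Proof.
apply: differentiableD; first exact: differentiable_cst.
apply: differentiable_bigsum => i; apply: differentiableM.
  by apply: differentiableM; [exact: differentiable_cst|exact: differentiable_coord].
exact: differentiable_cst.
Qed.

Definition blaschke_map z : Cd := \row_k blaschke (z 0 k).

(** The closed polydisc, rather than the open one, is what properness needs. *)
Definition induced (f : Cd -> Cd) := forall z, (forall k, `|z 0 k| <= 1) ->
  f (symmetrization z) = symmetrization (blaschke_map z) /\
  differentiable f (symmetrization z).

Lemma induced_exists : exists f : Cd -> Cd, induced f.
Proof.
have [f fP] := @symmetric_rational R d ('X ^+ 2 * (2%:P * 'X - 1)) (2%:P - 'X).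
exists f => z z1; have [|fz df] := fP z.
  by move=> k; rewrite !hornerE; exact: blaschke_den.
split=> //; rewrite fz; congr symmetrization; apply/rowP => k.
by rewrite !mxE !hornerE.
Qed.

Lemma induced_eq f z : induced f -> polydisc R d z ->
  f (symmetrization z) = symmetrization (blaschke_map z).
Proof. by move=> fP z1; have [] := fP _ (fun k => ltW (z1 k)). Qed.

Lemma induced_differentiable f z : induced f -> polydisc R d z ->
  differentiable f (symmetrization z).
Proof. by move=> fP z1; have [] := fP _ (fun k => ltW (z1 k)). Qed.

End Symmetrization.

(** * Regular points *)

Section Critical.
Variable R : realType.

(** The critical points other than [0] are the roots of [4 x^2 - 13 x + 4]
    ([secant_diag]); only one of them is in the disc. *)
Definition critical_values : seq (C R) :=
  [seq blaschke x | x <- [:: 0; (13 + sqrtC 105) / 8; (13 - sqrtC 105) / 8]].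

Lemma critical_point_value (x : C R) :
  secant x x = 0 -> blaschke x \in critical_values.
Proof.
rewrite secant_diag => /eqP; rewrite oppr_eq0 => x0; apply: map_f.
move: x0; rewrite mulf_eq0 !inE => /orP[->//|].
have -> : 4 * x ^+ 2 - 13 * x + 4 =
    4 * ((x - (13 + sqrtC 105) / 8) * (x - (13 - sqrtC 105) / 8)).
  (* Once 105 is written as a square, the identity is rational in its root. *)
  have s2 : sqrtC (105 : C R) ^+ 2 = 105 by exact: sqrtCK.
  have -> : 4 * x ^+ 2 - 13 * x + 4 =
      4 * x ^+ 2 - 13 * x + (169 - sqrtC (105 : C R) ^+ 2) / 16.
    by rewrite s2; field.
  by field.
rewrite !mulf_eq0 pnatr_eq0 /= !subr_eq0.
by case/orP=> ->; rewrite ?orbT.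
Qed.

Lemma blaschke_fibre (w : C R) :
  exists rs : seq (C R), forall x, 2 - x != 0 -> (x \in rs) = (blaschke x == w).
Proof.
pose p : {poly C R} := 'X ^+ 2 * (2%:P * 'X - 1) - w%:P * (2%:P - 'X).
have pE x : p.[x] = x ^+ 2 * (2 * x - 1) - w * (2 - x) by rewrite /p !hornerE.
have p0 : p != 0.
  apply/eqP => p0; have := pE 2; rewrite p0 horner0 subrr mulr0 subr0 => /esym/eqP.
  have -> : 2 ^+ 2 * (2 * 2 - 1) = 12%:R :> C R by ring.
  by rewrite pnatr_eq0.
have [rs rsE] := closed_field_poly_normal p.
exists rs => x x0; have -> : (x \in rs) = root p x.
  by rewrite rsE rootZ ?lead_coef_eq0 // root_prod_XsubC.
rewrite /root pE subr_eq0 /blaschke; apply/eqP/eqP => [->|<-].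
  by rewrite mulfK.
by rewrite divfK.
Qed.

Lemma blaschke_fibres (ws : seq (C R)) :
  exists rs : seq (C R), forall x, 2 - x != 0 -> (x \in rs) = (blaschke x \in ws).
Proof.
elim: ws => [|w ws [rs rsE]]; first by exists [::].
have [r rE] := blaschke_fibre w.
by exists (r ++ rs) => x x0; rewrite mem_cat rE // rsE // inE.
Qed.

End Critical.

Section Regular.
Variables (R : realType) (d : nat).
Local Notation Cd := 'rV[C R]_d.
Implicit Types (z u s : Cd).

Definition regular z := [/\ polydisc R d z, injective (blaschke_map z 0) &
  forall k, blaschke (z 0 k) \notin critical_values R].

Lemma near_polydisc z : polydisc R d z -> \forall y \near z, polydisc R d y.
Proof.
move=> z1; pose near_i i (y : Cd) := `|y 0 i| < 1.
have z_near i : \forall y \near z, near_i i y.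
  exact: (@coord_continuous _ _ _ 0 i z _ (near_norm_lt (z1 i))).
exact: (@filter_forall _ _ near_i (nbhs z) _ z_near).
Qed.

Lemma blaschke_map_polydisc z : polydisc R d z -> polydisc R d (blaschke_map z).
Proof. by move=> z1 k; rewrite mxE; exact: blaschke_lt1. Qed.

(** Regularity only depends on the symmetrization of [blaschke_map z]. *)
Lemma regular_transfer z u : polydisc R d u ->
  symmetrization (blaschke_map u) = symmetrization (blaschke_map z) ->
  regular z -> regular u.
Proof.
move=> u1 e [z1 iz cz]; split=> //; first exact: symmetrization_inj (esym e) iz.
move=> k; have [l] := symmetrization_mem e k.
by rewrite !mxE => ->.
Qed.

Lemma blaschke_coord_differentiable k z : `|z 0 k| <= 1 ->
  differentiable (fun z : Cd => blaschke (z 0 k)) z.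
Proof.
move=> zk; rewrite /blaschke.
have dk : differentiable (fun z : Cd => z 0 k) z by exact: differentiable_coord.
apply: differentiableM.
  apply: differentiableM; first exact: differentiable_pow.
  apply: differentiableB; last exact: differentiable_cst.
  by apply: differentiableM; [exact: differentiable_cst | exact: dk].
apply: differentiableV; last exact: blaschke_den.
by apply: differentiableB; [exact: differentiable_cst | exact: dk].
Qed.

Variable f : Cd -> Cd.
Hypothesis fP : induced f.

(** Compose the induced map on the right with the symmetrization and on the left
    with the evaluation [E] of monic polynomials at the points
    [w j = blaschke (z j)]. The [j]-th coordinate of the composite at [y] is
    the product of the [w j - blaschke (y k)]. Its factor [k = j] vanishes at
    [y = z], so its derivative there is the product of the other factors with
    the derivative of that one: the Jacobian matrix of the composite is
    diagonal and invertible. By the chain rule that of the induced map is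
    invertible too; the symmetrization never has to be differentiated
    explicitly. *)
Lemma regular_jacobian z : regular z -> Jac f (symmetrization z) != 0.
Proof.
move=> [z1 iz cz].
pose w := blaschke_map z.
pose E s : Cd := \row_j monic_eval s (w 0 j).
have dE s : differentiable E s.
  by apply: differentiable_row => j; exact: monic_eval_differentiable.
have ds := symmetrization_differentiable z.
have df := induced_differentiable fP z1.
have dfs : differentiable (f \o @symmetrization R d) z.
  exact: (differentiable_comp ds df).
have dF : differentiable (E \o (f \o @symmetrization R d)) z.
  exact: (differentiable_comp dfs (dE _)).
(* The coordinate of index [j] is [(z j - y j) * Q j y] near [z]. *)
pose Q j (y : Cd) : C R := secant (z 0 j) (y 0 j) / ((2 - z 0 j) * (2 - y 0 j)) *
  \prod_(k < d | k != j) (w 0 j - blaschke (y 0 k)).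
have dQ j : differentiable (Q j) z.
  apply: differentiableM; last first.
    apply: differentiable_bigprod => k _.
    apply: differentiableB; first exact: differentiable_cst.
    by apply: blaschke_coord_differentiable; exact: ltW.
  have dj : differentiable (fun z : Cd => z 0 j) z by exact: differentiable_coord.
  have d2j : differentiable (fun z : Cd => 2 - z 0 j) z.
    by apply: differentiableB; [exact: differentiable_cst | exact: dj].
  apply: differentiableM.
    have d21 : differentiable (fun y : Cd => 2 * y 0 j - 1) z.
      apply: differentiableB; last exact: differentiable_cst.
      by apply: differentiableM; [exact: differentiable_cst | exact: dj].
    have d2x : differentiable (fun y : Cd => 2 * y 0 j) z.
      by apply: differentiableM; [exact: differentiable_cst | exact: dj].
    rewrite /secant; apply: differentiableD; last by apply: differentiableM.
    apply: differentiableD; last first.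
      apply: differentiableM; last exact: differentiable_cst.
      by apply: differentiableM.
    apply: differentiableM; last exact: differentiable_cst.
    by apply: differentiableM; [exact: differentiable_cst | exact: d2j].
  have z2 : 2 - z 0 j != 0 by apply: blaschke_den; exact: ltW.
  apply: differentiableV; last by rewrite mulf_neq0.
  by apply: differentiableM; [exact: differentiable_cst | exact: d2j].
have Q0 j : Q j z != 0.
  rewrite /Q mulf_neq0 //.
    rewrite mulf_neq0 ?invr_eq0 ?mulf_neq0 ?blaschke_den ?ltW //.
    apply/eqP => /critical_point_value.
    by apply/negP; exact: cz.
  apply/prodf_neq0 => k kj; rewrite subr_eq0 mxE eq_sym.
  by apply: contra_neq kj => e; apply: iz; rewrite !mxE.
have FE j : \forall y \near z, (E \o (f \o @symmetrization R d)) y 0 j =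
    (z 0 j - y 0 j) * Q j y.
  apply: filterS (near_polydisc z1) => y y1.
  rewrite /= mxE (induced_eq fP) // monic_eval_symmetrization (bigD1 j) //= !mxE.
  rewrite blaschke_sub ?blaschke_den ?ltW // /Q [RHS]mulrA; congr (_ * _).
  by apply: eq_bigr => k _; rewrite !mxE.
have jacF : jacobian (E \o (f \o @symmetrization R d)) z = diag_mx (\row_j - Q j z).
  apply/matrixP => i j; rewrite jacobian_entry // (near_eq_derive _ (FE j)).
  pose c (y : Cd) := y 0 j.
  have dc : differentiable c z by exact: differentiable_coord.
  have cD : 'D_(delta_mx 0 i) c z = (i == j)%:R.
    by rewrite deriveE // diff_proj mxE eqxx eq_sym.
  pose A : Cd -> C R := cst (z 0 j) - c.
  have AD : 'D_(delta_mx 0 i) A z = - (i == j)%:R.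
    rewrite deriveB; [|exact: derivable_cst|exact: diff_derivable].
    by rewrite derive_cst sub0r cD.
  have dA : differentiable A z.
    by apply: differentiableB; [exact: differentiable_cst|exact: dc].
  have dAv : derivable A z (delta_mx 0 i) by exact: diff_derivable.
  have dQv : derivable (Q j) z (delta_mx 0 i) by apply: diff_derivable; exact: dQ.
  have M := deriveM dAv dQv.
  have -> : (fun y : Cd => (z 0 j - y 0 j) * Q j y) = A * Q j by [].
  rewrite M AD !mxE.
  have -> : A z = 0 by exact: subrr.
  rewrite scale0r add0r scalerN; have [->|_] := eqVneq i j.
    by rewrite mulr1n; exact: (congr1 -%R (mulr1 _)).
  by rewrite scaler0 mulr0n oppr0.
have detF : \det (jacobian (E \o (f \o @symmetrization R d)) z) != 0.
  rewrite jacF det_diag; apply/prodf_neq0 => j _; rewrite mxE oppr_eq0.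
  exact: Q0.
apply: contra_neq detF => detf; move: detf; rewrite /Jac => detf.
have det0 (A B D : 'M[C R]_d) : \det B = 0 -> \det (A *m B *m D) = 0.
  by move=> B0; rewrite !det_mulmx B0 mulr0 mul0r.
rewrite (jacobian_comp dfs (dE _)) (jacobian_comp ds df).
exact: det0 detf.
Qed.

End Regular.

(** * Deck transformations *)

Section DeckGroup.
Variables (R : realType) (d : nat).
Local Notation Cd := 'rV[C R]_d.
Local Notation G := (symmetrized_polydisc R d).
Implicit Types (z u s : Cd).

(** Roots depend continuously on the polynomial: the value at [v0] is the product
    of the distances to the roots, and cannot be smaller than [e ^+ d] if all
    of these are at least [e]. *)
Lemma root_near (T : topologicalType) (S : T -> Cd) (x : T) (v0 e : C R) :
  continuous_at x S -> monic_eval (S x) v0 = 0 -> 0 < e ->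
  \forall y \near x, forall u, S y = symmetrization u ->
    exists k, `|v0 - u 0 k| < e.
Proof.
move=> Sc v00 e0.
have mc : continuous_at x (fun y => monic_eval (S y) v0).
  apply: (@continuous_comp _ _ _ S (fun s => monic_eval s v0)); first exact: Sc.
  by apply: differentiable_continuous; exact: monic_eval_differentiable.
have ed0 : 0 < e ^+ d by rewrite exprn_gt0.
have near_small : \forall y \near x,
    `|monic_eval (S x) v0 - monic_eval (S y) v0| < e ^+ d.
  exact: (cvgr_dist_lt _ _ mc).
apply: filterS near_small => y + u Su; rewrite v00 sub0r normrN Su.
rewrite monic_eval_symmetrization normr_prod => small.
apply: contrapT => far; move: small; apply/negP.
have prod_ge : e ^+ d <= \prod_(k < d) `|v0 - u 0 k|.
  have -> : e ^+ d = \prod_(k < d) e by rewrite prodr_const card_ord.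
  apply: ler_prod => k _; rewrite ltW //= (real_leNgt (gtr0_real e0) (normr_real _)).
  by apply/negP => near; apply: far; exists k.
by rewrite (le_gtF prod_ge).
Qed.

Variable f : Cd -> Cd.
Hypothesis fP : induced f.
Local Notation D := (covering_space G f).

Lemma regular_covering z : regular z -> D (symmetrization z).
Proof.
move=> zr; have [z1 _ _] := zr; split; first by exists z.
move=> [_ [[u u1 <-] J0]]; rewrite !(induced_eq fP) // => e.
by have := regular_jacobian fP (regular_transfer u1 e zr); rewrite J0 eqxx.
Qed.

Variable h : Cd -> Cd.
Hypothesis hD : Deck G f h.

Let h_lift s : D s -> exists u, [/\ polydisc R d u, h s = symmetrization u &
  f (symmetrization u) = f s].
Proof.
move=> Ds; case: hD => [[_ [hDD _]] fh _]; have [[u u1 su] _] := hDD s Ds.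
by exists u; split => //; rewrite su fh.
Qed.

Let h_continuous s : D s -> continuous_at s h.
Proof.
by case: hD => [[hh _] _ _] Ds; apply: differentiable_continuous; exact: hh.
Qed.

Definition set_coord z (i : 'I_d) (x : C R) : Cd :=
  \row_k (if k == i then x else z 0 k).

Lemma set_coord_continuous z i x : continuous_at x (set_coord z i).
Proof.
apply: differentiable_continuous; apply: differentiable_row => k.
by case: (k == i); [exact: ex_diff | exact: differentiable_cst].
Qed.

Lemma set_coord_regular z i x : regular z -> `|x| < 1 ->
  blaschke x \notin critical_values R ->
  (forall j, j != i -> blaschke x != blaschke (z 0 j)) -> regular (set_coord z i x).
Proof.
move=> [z1 iz cz] x1 cx xz; split.
- by move=> k; rewrite mxE; case: (k == i).
- move=> k l; rewrite !mxE; have [->|ki] := eqVneq k i; have [->|li] := eqVneq l i => //.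
  + by move=> /eqP; rewrite (negbTE (xz _ li)).
  + by move=> /esym/eqP; rewrite (negbTE (xz _ ki)).
  + by move=> e; apply: iz; rewrite !mxE.
- by move=> k; rewrite mxE; case: (k == i).
Qed.

Lemma set_coord_id z i : set_coord z i (z 0 i) = z.
Proof. by apply/rowP => k; rewrite mxE; case: eqVneq => // ->. Qed.

(** It suffices that each [z i] be a root of [h (symmetrization z)]. Let [x]
    replace [z i] and run over the disc, punctured where [set_coord z i x] is
    not regular. The roots of [h (symmetrization (set_coord z i x))] are
    in the fibres of the [z j] for [j != i], and one root [v x] is in the fibre
    of [x]. As the first fibres stay away from that of [x], the root [v x] is
    followed continuously. *)
Lemma deck_fixes_regular z : regular z -> h (symmetrization z) = symmetrization z.
Proof.
move=> zr; have [z1 iz cz] := zr.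
have [u0 [u01 hu0 _]] := h_lift (regular_covering zr).
rewrite hu0; apply/esym; apply: eq_symmetrization.
  by move=> k l e; apply: iz; rewrite !mxE e.
move=> i.
pose zs := [seq blaschke (z 0 j) | j <- enum 'I_d & j != i].
pose ws := critical_values R ++ zs.
have [rs rsE] := blaschke_fibres ws.
have W_regular x : punctured_disc rs x -> regular (set_coord z i x).
  move=> [x1]; rewrite rsE ?blaschke_den ?ltW // mem_cat negb_or => /andP[cx xz].
  apply: set_coord_regular => // j ji; apply: contra xz => /eqP ->.
  by apply: map_f; rewrite mem_filter ji mem_enum.
have W_lift x : exists v, punctured_disc rs x -> exists u, [/\ polydisc R d u,
    h (symmetrization (set_coord z i x)) = symmetrization u,
    exists l, v = u 0 l & blaschke v = blaschke x].
  have [Wx|] := pselect (punctured_disc rs x); last by exists 0.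
  have xr := W_regular x Wx; have [u [u1 hu fu]] := h_lift (regular_covering xr).
  have xr1 : polydisc R d (set_coord z i x) by case: xr.
  move: fu; rewrite !(induced_eq fP) // => /esym/symmetrization_mem/(_ i)[l].
  rewrite !mxE eqxx => e; exists (u 0 l) => _.
  by exists u; split => //; exists l.
have [v vP] := choice W_lift.
have critical x : secant x x = 0 -> x \in rs.
  move=> x0; have x2 : 2 - x != 0.
    apply: contra_eq_neq x0 => /eqP; rewrite subr_eq0 => /eqP <-.
    have -> : secant 2 2 = 12%:R :> C R by rewrite secant_diag; ring.
    by rewrite pnatr_eq0.
  by rewrite rsE // mem_cat critical_point_value.
have v_lt1 x : punctured_disc rs x -> `|v x| < 1.
  by move=> /vP[u [u1 _ [l ->] _]].
have v_lift x : punctured_disc rs x -> blaschke (v x) = blaschke x.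
  by move=> /vP[u [_ _ _ ->]].
have Wzi : punctured_disc rs (z 0 i).
  split; first exact: z1.
  rewrite rsE ?blaschke_den ?ltW // mem_cat negb_or cz /=.
  apply/mapP => -[j]; rewrite mem_filter => /andP[ji _] e.
  by case/eqP: ji; apply: iz; rewrite !mxE e.
have S_continuous x : punctured_disc rs x ->
    continuous_at x (fun y => h (symmetrization (set_coord z i y))).
  move=> Wx; apply: continuous_comp; last first.
    exact: h_continuous (regular_covering (W_regular x Wx)).
  apply: continuous_comp; first exact: set_coord_continuous.
  by apply: differentiable_continuous; exact: symmetrization_differentiable.
have W_open x : punctured_disc rs x -> \forall y \near x, punctured_disc rs y.
  move=> [x1 xrs]; apply: filterS2 (near_norm_lt x1) (near_notin_seq rs x) => y y1 yrs.
  by split=> //; have [->//|] := eqVneq y x.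
have v_continuous x : punctured_disc rs x -> continuous_at x v.
  move=> Wx; apply/cvgrPdist_lt => e e0.
  have [u [u1 hu [l vl] vB]] := vP x Wx.
  have root_vx : monic_eval (h (symmetrization (set_coord z i x))) (v x) = 0.
    by rewrite hu monic_eval_symmetrization (bigD1 l) //= vl subrr mul0r.
  have near_sep : \forall y \near v x, blaschke y \notin zs.
    have vx2 : 2 - v x != 0 by apply: blaschke_den; apply: ltW; exact: v_lt1.
    have near_zs : \forall w \near blaschke (v x), w \notin zs.
      apply: filterS (near_notin_seq zs _) => w wzs.
      have [->|] := eqVneq w (blaschke (v x)); last exact: wzs.
      rewrite vB; case: Wx => x1.
      by rewrite rsE ?blaschke_den ?ltW // mem_cat negb_or => /andP[].
    exact: (blaschke_continuous vx2 near_zs).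
  have [r /= r0 sepr] := (nbhs_ballP _ _).1 (filterI near_sep (near_dist_lt (v x) e0)).
  rewrite -ball_normE in sepr.
  have near_roots := root_near (S_continuous x Wx) root_vx r0.
  apply: filterS2 (W_open x Wx) near_roots => y Wy roots_y.
  have [u' [u'1 hu' [l' vl'] vB']] := vP y Wy.
  have [k /sepr[sepk vxk]] := roots_y u' hu'.
  have yr := W_regular y Wy; have [yr1 iy _] := yr.
  have same_fibre : symmetrization (blaschke_map u') =
      symmetrization (blaschke_map (set_coord z i y)).
    by rewrite -!(induced_eq fP) // -hu'; case: hD => _ fh _; exact: fh (regular_covering yr).
  (* The root close to [v x] is in the fibre of [y] and not in another one. *)
  have [m] := symmetrization_mem same_fibre k; rewrite !mxE.
  have [_ Bk|mi Bk] := eqVneq m i; last first.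
    by case/negP: sepk; rewrite Bk; apply: map_f; rewrite mem_filter mi mem_enum.
  suff -> : v y = u' 0 k by [].
  rewrite vl'; congr (u' 0 _); apply: (symmetrization_inj (esym same_fibre) iy).
  by rewrite !mxE Bk -vB' vl'.
have vzi := lift_identity critical v_continuous v_lt1 v_lift Wzi.
have [u [_ hu [l vl] _]] := vP _ Wzi.
move: hu; rewrite set_coord_id hu0 => /esym/symmetrization_mem/(_ l).
by rewrite -vl vzi.
Qed.

Lemma exists_near_notin (rs : seq (C R)) (x e : C R) : `|x| < 1 -> 0 < e ->
  exists y, [/\ `|y| < 1, `|x - y| < e & y \notin rs].
Proof.
move=> x1 e0.
have [r /= r0 Hr] := (nbhs_ballP _ _).1
  (filterI (filterI (near_norm_lt x1) (near_dist_lt x e0)) (near_notin_seq rs x)).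
rewrite -ball_normE in Hr.
have [|[y1 ey] yrs] := Hr (x + r / 2).
  rewrite /= opprD addrA subrr add0r normrN gtr0_norm ?divr_gt0 //.
  by rewrite ltr_pdivrMr // ltr_pMr // ltr1n.
exists (x + r / 2); split=> //; apply: yrs.
by rewrite -subr_eq0 addrAC subrr add0r mulf_neq0 ?invr_eq0 ?pnatr_eq0 // gt_eqF.
Qed.

(** The coordinates are perturbed one after the other, each time away from the
    fibres of the previous ones and of the critical values. *)
Lemma regular_dense z (e : C R) : polydisc R d z -> 0 < e ->
  exists z', regular z' /\ forall k, `|z 0 k - z' 0 k| < e.
Proof.
move=> z1 e0.
suff /(_ d (leqnn d)) [z' [z'1 ez iz cz]] : forall n, (n <= d)%N -> exists z',
    [/\ polydisc R d z', forall k, `|z 0 k - z' 0 k| < e,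
    forall j k : 'I_d, (j < n)%N -> (k < n)%N ->
      blaschke (z' 0 j) = blaschke (z' 0 k) -> j = k &
    forall k : 'I_d, (k < n)%N -> blaschke (z' 0 k) \notin critical_values R].
  exists z'; split=> //; split=> //; last by move=> k; exact: cz.
  by move=> j k; rewrite !mxE; apply: iz.
elim=> [_|n IH nd].
  by exists z; split=> // k; rewrite subrr normr0.
have [z' [z'1 ez iz cz]] := IH (ltnW nd).
pose i := Ordinal nd.
have [rs rsE] := blaschke_fibres
  (critical_values R ++ [seq blaschke (z' 0 j) | j <- enum 'I_d]).
have [x [x1 ex]] := exists_near_notin rs (z1 i) e0.
rewrite rsE ?blaschke_den ?ltW // mem_cat negb_or => /andP[cx xz].
have {}xz j : blaschke x != blaschke (z' 0 j).
  by apply: contra xz => /eqP ->; apply: map_f; rewrite mem_enum.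
have ltn (k : 'I_d) : k != i -> (k < n.+1)%N -> (k < n)%N.
  by rewrite ltnS leq_eqVlt -val_eqE /= => /negbTE ->.
exists (set_coord z' i x); split.
- by move=> k; rewrite mxE; case: (k == i).
- by move=> k; rewrite mxE; case: eqVneq => [->|].
- move=> j k; rewrite !mxE; have [->|ji] := eqVneq j i; have [->|ki] := eqVneq k i => //.
  + by move=> _ _ /eqP; rewrite (negbTE (xz k)).
  + by move=> _ _ /esym/eqP; rewrite (negbTE (xz j)).
  + by move=> /(ltn _ ji) jn /(ltn _ ki) kn; exact: iz.
- move=> k; rewrite mxE; have [->//|ki] := eqVneq k i.
  by move=> /(ltn _ ki); exact: cz.
Qed.

Lemma deck_trivial : h = id.
Proof.
apply/funext => s; have [Ds|nDs] := pselect (D s); last by case: hD => _ _; exact.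
have [[z z1 zs] _] := Ds.
apply: contrapT => hs; rewrite -zs in hs Ds.
have dist_continuous : continuous_at z (fun y => h (symmetrization y) - symmetrization y).
  have sc : continuous_at z (@symmetrization R d).
    by apply: differentiable_continuous; exact: symmetrization_differentiable.
  apply: cvgB; last exact: sc.
  by apply: continuous_comp; [exact: sc | exact: h_continuous].
have dist0 : h (symmetrization z) - symmetrization z != 0.
  by rewrite subr_eq0; apply/eqP.
have [r /= r0 Hr] := (nbhs_ballP _ _).1 (cvgr_neq0 _ dist_continuous dist0).
have [z' [zr' zz']] := regular_dense z1 r0.
have /Hr : ball z r z'.
  by split=> // i j; rewrite (ord1 i) -ball_normE; exact: zz'.
by rewrite /= deck_fixes_regular // subrr eqxx.
Qed.

End DeckGroup.

(** * Properness *)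

Section Compactness.
Variables (R : realType) (d : nat).
Local Notation Cd := 'rV[C R]_d.

Lemma closed_unit_disc_compact : compact [set x : C R | `|x| <= 1].
Proof.
pose sq (p : R * R) : C R := cplx p.1 + Complex 0 1 * cplx p.2.
have sqc : continuous sq.
  move=> p; apply: continuous_add.
    by apply: continuous_comp; [exact: cvg_fst | exact: cplx_continuous].
  apply: continuous_mul; first exact: continuous_cst.
  by apply: continuous_comp; [exact: cvg_snd | exact: cplx_continuous].
have box : compact (sq @` (`[(-1 : R), 1] `*` `[(-1 : R), 1])).
  apply: continuous_compact; first exact: continuous_subspaceT.
  by apply: compact_setX; exact: segment_compact.
have normE (x : C R) : (`|x| <= 1) = (Cre `|x| <= 1).
  by rewrite -[in LHS](cplx_Cre (normr_real x)) (cplx_le _ 1).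
apply: subclosed_compact box _.
  rewrite (_ : mkset _ = [set x | Cre `|x| <= 1]); last first.
    by apply/seteqP; split=> x /=; rewrite normE.
  have nc : continuous (fun x : C R => Cre `|x|).
    by move=> x; apply: continuous_comp; [exact: norm_continuous | exact: Cre_continuous].
  exact: ((continuous_closedP _).1 nc _ (@closed_le R 1)).
move=> x /= x1; exists (complex.Re x, complex.Im x); last first.
  by rewrite /sq /cplx; case: x {x1} => a b; apply/eqP; rewrite eq_complex /=;
     apply/andP; split; apply/eqP; ring.
have Re1 : `|complex.Re x| <= 1.
  rewrite -cplx_le; apply: le_trans x1; exact: normc_ge_Re.
have Im1 : `|complex.Im x| <= 1.
  rewrite -cplx_le; apply: le_trans x1.
  have := normc_ge_Re (x * 'i%C).
  by rewrite ReiNIm normrN normrM complexiE normCi mulr1.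
by split; rewrite /= in_itv /= -ler_norml.
Qed.

Lemma closed_polydisc_compact : compact [set z : Cd | forall k, `|z 0 k| <= 1].
Proof.
apply: (@rV_compact _ d (fun=> [set x : C R | `|x| <= 1])) => _.
exact: closed_unit_disc_compact.
Qed.

Lemma closed_setI_preimage (T U : topologicalType) (A : set T) (K : set U) (g : T -> U) :
  closed A -> closed K -> (forall x, A x -> continuous_at x g) ->
  closed (A `&` g @^-1` K).
Proof.
move=> Ac Kc gc x xcl.
have Ax : A x by apply: Ac => V /xcl [y [[Ay _] Vy]]; exists y.
split=> //; apply: Kc => V /(gc x Ax) /xcl[y [[_ Ky] Vy]].
by exists (g y).
Qed.

End Compactness.

Section Proper.
Variables (R : realType) (d : nat).
Local Notation Cd := 'rV[C R]_d.
Local Notation G := (symmetrized_polydisc R d).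
Implicit Type z : Cd.
Variable f : Cd -> Cd.
Hypothesis fP : induced f.

(** Points of the unit circle are mapped to the unit circle. *)
Lemma blaschke_map_inv_polydisc (z : Cd) : (forall k, `|z 0 k| <= 1) ->
  polydisc R d (blaschke_map z) -> polydisc R d z.
Proof.
move=> z1 Bz k; rewrite lt_neqAle z1 andbT; apply/eqP => /blaschke_norm1 Bk.
by have := Bz k; rewrite mxE Bk ltxx.
Qed.

(** The preimage of [K] is the image under the symmetrization of a closed subset
    of the compact closed polydisc. *)
Lemma induced_proper : proper_holomorphic G G f.
Proof.
split.
- by move=> _ [z z1 <-]; exact: induced_differentiable.
- move=> _ [z z1 <-]; rewrite induced_eq //.
  by exists (blaschke_map z) => //; exact: blaschke_map_polydisc.
move=> K KG Kco.
have Cd_hausdorff : hausdorff_space Cd by exact: norm_hausdorff.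
pose A := [set z : Cd | forall k, `|z 0 k| <= 1].
pose g (z : Cd) := symmetrization (blaschke_map z).
have gc z : A z -> continuous_at z g.
  move=> z1; apply: continuous_comp; apply: differentiable_continuous.
    apply: differentiable_row => k; exact: blaschke_coord_differentiable.
  exact: symmetrization_differentiable.
have Aco : compact A by exact: closed_polydisc_compact.
have Acl : closed A by exact: compact_closed.
have AKco : compact (A `&` g @^-1` K).
  apply: subclosed_compact Aco _; last by move=> z [].
  by apply: closed_setI_preimage;
    [exact: Acl | exact: compact_closed Kco | exact: gc].
have -> : G `&` f @^-1` K = @symmetrization R d @` (A `&` g @^-1` K).
  apply/seteqP; split=> [_ [[z z1 <-] /= Kfz]|_ [z [z1 Kgz] <-]].
    exists z => //; split=> [k|]; first exact: ltW.
    by rewrite /g /= -(induced_eq fP z1).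
  (* [K] avoids the image of the boundary, hence [z] is in the open polydisc. *)
  have [w w1 gw] := KG _ Kgz.
  have Bz := polydisc_symmetrization (esym gw) w1.
  split; first by exists z => //; exact: blaschke_map_inv_polydisc Bz.
  by have [fz _] := fP z1; rewrite /= fz.
apply: continuous_compact => //; apply: continuous_subspaceT => z.
by apply: differentiable_continuous; exact: symmetrization_differentiable.
Qed.

Lemma induced_not_biholomorphic : (0 < d)%N -> ~ biholomorphic G G f.
Proof.
move=> d0 [_ [_ [g [_ _ gK _]]]].
pose c (x : C R) : Cd := const_mx x.
have c1 x : `|x| < 1 -> polydisc R d (c x) by move=> x1 k; rewrite mxE.
have gc x : `|x| < 1 -> blaschke x = 0 -> symmetrization (c x) = g (symmetrization (c 0)).
  move=> x1 Bx; rewrite -[LHS]gK; last by exists (c x) => //; exact: c1.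
  rewrite (induced_eq fP (c1 x x1)).
  by congr (g (symmetrization _)); apply/rowP => k; rewrite !mxE.
have h1 : `|2^-1 : C R| < 1 by rewrite normfV normr_nat invf_lt1 ?ltr1n.
have B0 : blaschke (0 : C R) = 0 by rewrite /blaschke expr0n !mul0r.
have Bh : blaschke (2^-1 : C R) = 0.
  by rewrite /blaschke divff ?pnatr_eq0 // subrr mulr0 mul0r.
have n0 : `|0 : C R| < 1 by rewrite normr0.
have e : symmetrization (c 2^-1) = symmetrization (c 0).
  exact: etrans (gc _ h1 Bh) (esym (gc _ n0 B0)).
have [l] := symmetrization_mem e (Ordinal d0).
by rewrite !mxE => /eqP; rewrite invr_eq0 pnatr_eq0.
Qed.

End Proper.

Lemma id_deck (R : realType) (d : nat) (Omega : set 'rV[C R]_d) f :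
  Deck Omega f id.
Proof.
split=> //; split; first by move=> z _; exact: ex_diff.
split=> //; exists id; split=> // z _; exact: ex_diff.
Qed.

Theorem proposition3p9 (R : realType) (d : nat) (d_gt0 : (0 < d)%N) :
  exists f : 'rV[C R]_d -> 'rV[C R]_d,
    [/\ proper_holomorphic (symmetrized_polydisc R d)
          (symmetrized_polydisc R d) f,
        ~ biholomorphic (symmetrized_polydisc R d)
            (symmetrized_polydisc R d) f &
        Deck (symmetrized_polydisc R d) f = [set id]].
Proof.
have [f fP] := induced_exists R d; exists f; split.
- exact: induced_proper.
- exact: induced_not_biholomorphic.
- apply/seteqP; split=> [h /(deck_trivial fP)//|_ ->]; exact: id_deck.
Qed.
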